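(* Let $M$ be a smooth manifold, $h$ a non-degenerate symmetric $(0,2)$-tensor field and $\nabla$ a torsion-free affine connection on $M$ such that $(M,h,\nabla)$ is a statistical manifold. Let $J:TM\to TM$ be an $h$-symmetric $(1,1)$-tensor field and let $$\hat J=\begin{pmatrix} J & (I-J^2)h^{-1}\\ h & -J^*\end{pmatrix}$$ be the generalized almost product structure on $TM\oplus T^*M$ induced by $(h,J)$. Then the Nijenhuis tensor field of $\hat J$ with respect to $[\cdot,\cdot]_{\nabla^{(\alpha)}}$ satisfies $$N_{\hat J}^{\nabla^{(\alpha)}}(X+\eta,Y+\beta)=N_{\hat J}^{\nabla}(X+\eta,Y+\beta)$$ for all vector fields $X,Y$, all $1$-forms $\eta,\beta$ and all $\alpha\in\mathbb{R}$ if and only if the tensor field $F(X,Y,Z)=h((\nabla_XJ)Y,Z)$ satisfies $$F(X,Y,Z)+F(Y,Z,X)-F(X,Z,Y)-F(Y,X,Z)=0$$ for all vector fields $X,Y,Z$ on $M$.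
   Context: The tensor $h$ is identified with the bundle isomorphism $h:TM\to T^*M$, $h(X)=h(X,\cdot)$, with inverse $h^{-1}$. $(M,h,\nabla)$ is a statistical manifold if $\nabla$ is torsion-free and $(\nabla_Xh)(Y,Z)=(\nabla_Yh)(X,Z)$ for all $X,Y,Z$. $J$ is $h$-symmetric if $h(JX,Y)=h(X,JY)$; $(J^*\eta)(X)=\eta(JX)$. The matrix means $\hat J(X+\eta)=JX+(I-J^2)h^{-1}(\eta)+h(X)-J^*\eta$. The dual connection $\nabla^*$ is defined by $X(h(Y,Z))=h(\nabla_XY,Z)+h(Y,\nabla^*_XZ)$, and $\nabla^{(\alpha)}=\frac{1+\alpha}{2}\nabla+\frac{1-\alpha}{2}\nabla^*$. For an affine connection $D$ on $M$ (acting on $1$-forms by $(D_X\beta)(Y)=X(\beta(Y))-\beta(D_XY)$), the bracket is $[X+\eta,Y+\beta]_D=[X,Y]+D_X\beta-D_Y\eta$, and the Nijenhuis tensor of an endomorphism $\hat J$ of $TM\oplus T^*M$ with respect to $D$ is $N_{\hat J}^{D}(\sigma,\tau)=[\hat J\sigma,\hat J\tau]_D-\hat J[\hat J\sigma,\tau]_D-\hat J[\sigma,\hat J\tau]_D+\hat J^2[\sigma,\tau]_D$. *)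

(* Defs.v *)
(* Smooth manifolds and their tensor calculus on global sections. Conventions:
   - a vector field is a derivation of the algebra C^oo(M); its value at p is
     the tangent vector f |-> X f p, a derivation at p;
   - 1-forms and (1,1)-, (0,2)-tensor fields are the C^oo(M)-(multi)linear maps
     on the C^oo(M)-module of vector fields. *)
From HB Require Import structures.
From mathcomp Require Import all_boot all_order all_algebra.
From mathcomp Require Import all_classical all_reals topology normedtype derive.
Import numFieldNormedType.Exports.
Import Order.TTheory GRing.Theory Num.Theory.
Set Implicit Arguments.
Unset Strict Implicit.
Unset Printing Implicit Defensive.
Local Open Scope classical_set_scope.
Local Open Scope ring_scope.

Section SmoothOn.
Variables (R : realType) (n : nat).
Implicit Types (U : set 'rV[R]_n) (f g : 'rV[R]_n -> R).

Fixpoint Ck (k : nat) U f : Prop :=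
  (forall x, U x -> {for x, continuous f}) /\
  match k with
  | 0 => True
  | k'.+1 => forall i : 'I_n,
      (forall x, U x -> derivable f x (delta_mx 0 i)) /\
      Ck k' U ('D_(delta_mx 0 i) f)
  end.

(* Meaningful for U open. *)
Definition smooth_on U f := forall k, Ck k U f.

Lemma Ck_ext k U f g : open U -> (forall x, U x -> f x = g x) ->
  Ck k U f -> Ck k U g.
Proof.
move=> oU; elim: k f g => [|k IH] f g fg [cf Hf].
all: have nfg x : U x -> {near x, f =1 g}.
1,3: by move=> Ux; near=> y; apply: fg; near: y; apply: open_nbhs_nbhs.
all: have cg x : U x -> {for x, continuous g}.
1,3: move=> Ux; have := cf x Ux; rewrite /prop_for /continuous_at (fg x Ux).
1,2: exact: cvg_trans (near_eq_cvg (nfg x Ux)).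
  by split.
split=> // i; have [df kf] := Hf i.
split=> [x Ux|]; first exact: near_eq_derivable (nfg x Ux) (df x Ux).
by apply: IH kf => x Ux; exact/near_eq_derive/nfg.
Unshelve. all: by end_near.
Qed.

Lemma CkW k U f : Ck k.+1 U f -> Ck k U f.
Proof.
elim: k f => [|k IH] f [cf Hf]; first by split.
by split=> // i; have [df kf] := Hf i; split=> //; apply: IH.
Qed.

Lemma Ck_cst k U (a : R) : Ck k U (cst a).
Proof.
have Hc b x : U x -> {for x, continuous (cst b : 'rV[R]_n -> R)}.
  by move=> _; exact: cst_continuous.
elim: k a => [|k IH] a; first by split=> // x; apply: Hc.
split=> [x|i]; first exact: Hc.
split=> [x _|]; first exact: derivable_cst.
have -> : 'D_(delta_mx 0 i) (cst a : 'rV[R]_n -> R) = cst 0; last exact: IH.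
by apply/funext => x; rewrite derive_cst.
Qed.

Lemma CkD k U f g : open U -> Ck k U f -> Ck k U g -> Ck k U (f + g).
Proof.
move=> oU; elim: k f g => [|k IH] f g [cf Hf] [cg Hg];
  (split; first by move=> x Ux; apply: continuousD; [apply: cf|apply: cg]).
  by [].
move=> i; have [df kf] := Hf i; have [dg kg] := Hg i.
split=> [x Ux|]; first by apply: derivableD; [apply: df|apply: dg].
apply: Ck_ext (IH _ _ kf kg) => // x Ux.
by rewrite deriveD //; [apply: df|apply: dg].
Qed.

Lemma CkM k U f g : open U -> Ck k U f -> Ck k U g -> Ck k U (f * g).
Proof.
move=> oU; elim: k f g => [|k IH] f g Cf Cg; have [cf Hf] := Cf;
  have [cg Hg] := Cg;
  (split; first by move=> x Ux; apply: continuousM; [apply: cf|apply: cg]).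
  by [].
move=> i; have [df kf] := Hf i; have [dg kg] := Hg i.
split=> [x Ux|]; first by apply: derivableM; [apply: df|apply: dg].
apply: Ck_ext (CkD oU (IH _ _ (CkW Cf) kg) (IH _ _ (CkW Cg) kf)) => // x Ux.
by rewrite deriveM //; [apply: df|apply: dg].
Qed.

End SmoothOn.

Section Manifold.
Variables (R : realType) (n : nat).

Record chart (T : topologicalType) := Chart {
  chart_dom : set T;
  chart_cod : set 'rV[R]_n;
  chart_to : T -> 'rV[R]_n;
  chart_from : 'rV[R]_n -> T;
  chart_dom_open : open chart_dom;
  chart_cod_open : open chart_cod;
  chart_to_cod : forall p, chart_dom p -> chart_cod (chart_to p);
  chart_from_dom : forall x, chart_cod x -> chart_dom (chart_from x);
  chart_toK : forall p, chart_dom p -> chart_from (chart_to p) = p;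
  chart_fromK : forall x, chart_cod x -> chart_to (chart_from x) = x;
  chart_to_continuous : forall p, chart_dom p -> {for p, continuous chart_to};
  chart_from_continuous :
    forall x, chart_cod x -> {for x, continuous chart_from} }.

Definition smoothly_compatible (T : topologicalType) (c d : chart T) :=
  forall i : 'I_n,
    smooth_on (chart_cod c `&` chart_from c @^-1` chart_dom d)
              (fun x => chart_to d (chart_from c x) 0 i).

(* The atlas is not required to be maximal: smoothness with respect to an atlas
   and to the maximal atlas containing it is the same. *)
Record manifold := Manifold {
  mcarrier :> topologicalType;
  atlas : set (chart mcarrier);
  manifold_hausdorff : hausdorff_space mcarrier;
  manifold_second_countable : @second_countable mcarrier;
  atlas_cover : forall p, exists2 c, atlas c & chart_dom c p;
  atlas_compatible :
    forall c d, atlas c -> atlas d -> smoothly_compatible c d }.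

End Manifold.

Section SmoothFunctions.
Variables (R : realType) (n : nat) (M : manifold R n).

Definition smooth_fun (f : M -> R) := forall c : chart R n M,
  atlas c -> smooth_on (chart_cod c) (f \o chart_from c).

Definition smooth_pred : {pred M -> R} := fun f => `[< smooth_fun f >].

Record Cinf := CinfSub {
  Cinf_val :> M -> R;
  Cinf_valP : Cinf_val \in smooth_pred }.

HB.instance Definition _ := [isSub for Cinf_val].
HB.instance Definition _ := [Choice of Cinf by <:].

Lemma smooth_pred_submod : submod_closed smooth_pred.
Proof.
split=> [|a f g /asboolP sf /asboolP sg].
  by apply/asboolP => c _ k; apply: Ck_cst.
apply/asboolP => c Ac k; have oc : open (chart_cod c) by exact: chart_cod_open.
exact: CkD oc (CkM oc (Ck_cst k _ a) (sf c Ac k)) (sg c Ac k).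
Qed.
HB.instance Definition _ :=
  GRing.isSubmodClosed.Build R (M -> R) smooth_pred smooth_pred_submod.

Lemma smooth_pred_mulr : mulr_closed smooth_pred.
Proof.
split=> [|f g /asboolP sf /asboolP sg].
  by apply/asboolP => c _ k; apply: Ck_cst.
apply/asboolP => c Ac k; have oc : open (chart_cod c) by exact: chart_cod_open.
exact: CkM oc (sf c Ac k) (sg c Ac k).
Qed.
HB.instance Definition _ :=
  GRing.isMulClosed.Build (M -> R) smooth_pred smooth_pred_mulr.

HB.instance Definition _ := GRing.SubChoice_isSubComPzRing.Build
  (M -> R) smooth_pred Cinf (GRing.subringClosedP _).
HB.instance Definition _ := [SubZmodule_isSubLmodule of Cinf by <:].

Definition Cinf_cst (a : R) : Cinf := a *: (1 : Cinf).

End SmoothFunctions.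

Section VectorFields.
Variables (R : realType) (n : nat) (M : manifold R n).

Definition derivation (D : Cinf M -> Cinf M) :=
  (forall (a : R) f g, D (a *: f + g) = a *: D f + D g) /\
  (forall f g, D (f * g) = D f * g + f * D g).

Definition derivation_pred : {pred Cinf M -> (Cinf M)^o} :=
  fun D => `[< derivation D >].

Record vfield := VField {
  vfield_val :> Cinf M -> (Cinf M)^o;
  vfield_valP : vfield_val \in derivation_pred }.

HB.instance Definition _ := [isSub for vfield_val].
HB.instance Definition _ := [Choice of vfield by <:].

Lemma Cinf_scaleAr (a : R) (f g : Cinf M) : f * (a *: g) = a *: (f * g).
Proof. by apply/val_inj/funext => p; rewrite /= /GRing.mul /= mulrCA. Qed.

Lemma derivation_pred_submod : submod_closed derivation_pred.
Proof.
split=> [|f D E /asboolP [Dl Dm] /asboolP [El Em]]; apply/asboolP; split.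
- move=> a g g'; rewrite -[LHS]/(0 : Cinf M).
  by rewrite -[RHS]/(a *: (0 : Cinf M) + 0) scaler0 addr0.
- move=> g g'; rewrite -[LHS]/(0 : Cinf M).
  by rewrite -[RHS]/((0 : Cinf M) * g' + g * 0) mul0r mulr0 addr0.
- move=> a g g'.
  rewrite -[LHS]/(f * D (a *: g + g') + E (a *: g + g')).
  rewrite -[RHS]/(a *: (f * D g + E g) + (f * D g' + E g')).
  by rewrite Dl El mulrDr Cinf_scaleAr scalerDr addrACA.
- move=> g g'.
  rewrite -[LHS]/(f * D (g * g') + E (g * g')).
  rewrite -[RHS]/((f * D g + E g) * g' + g * (f * D g' + E g')).
  by rewrite Dm Em !mulrDr mulrDl !mulrA (mulrC g f) addrACA.
Qed.
HB.instance Definition _ := GRing.isSubmodClosed.Build (Cinf M)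
  (Cinf M -> (Cinf M)^o) derivation_pred derivation_pred_submod.
HB.instance Definition _ := [SubChoice_isSubZmodule of vfield by <:].
HB.instance Definition _ := [SubZmodule_isSubLmodule of vfield by <:].

Lemma vfieldP (X : vfield) : derivation X.
Proof. exact/asboolP/vfield_valP. Qed.

Lemma vfieldD (X : vfield) f g : X (f + g) = X f + X g.
Proof. by have [Xl _] := vfieldP X; have := Xl 1 f g; rewrite !scale1r. Qed.

Lemma vfieldM (X : vfield) f g : X (f * g) = X f * g + f * X g.
Proof. by have [_ ->] := vfieldP X. Qed.

Fact lie_subproof (X Y : vfield) :
  (fun f : Cinf M => X (Y f) - Y (X f) : (Cinf M)^o) \in derivation_pred.
Proof.
have [Xl _] := vfieldP X; have [Yl _] := vfieldP Y.
apply/asboolP; split=> [a f g|f g] /=.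
  rewrite Yl Xl Xl Yl opprD addrACA; congr (_ + _).
  by rewrite -[RHS]/(a *: ((X (Y f) : Cinf M) - Y (X f))) scalerBr.
rewrite !vfieldM !vfieldD !vfieldM mulrBl mulrBr.
rewrite [X in X - _](AC (2*2) ((2*3)*(1*4))).
rewrite [X in _ - X](AC (2*2) ((3*2)*(1*4))).
by rewrite opprD addrACA subrr add0r opprD addrACA.
Qed.
Definition lie (X Y : vfield) : vfield := VField (lie_subproof X Y).

End VectorFields.

Section Tensors.
Variables (R : realType) (n : nat) (M : manifold R n).
Local Notation XM := (vfield M).

Definition oneform_pred : {pred XM -> (Cinf M)^o} := fun w => `[< linear w >].

Record oneform := OneForm {
  oneform_val :> XM -> (Cinf M)^o;
  oneform_valP : oneform_val \in oneform_pred }.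

HB.instance Definition _ := [isSub for oneform_val].
HB.instance Definition _ := [Choice of oneform by <:].

Lemma oneform_pred_submod : submod_closed oneform_pred.
Proof.
split=> [|f w v /asboolP wl /asboolP vl]; apply/asboolP => g X Y.
  by rewrite scaler0 addr0.
rewrite [LHS](_ : _ = f *: w (g *: X + Y) + v (g *: X + Y)) //.
rewrite [RHS](_ : _ = g *: (f *: w X + v X) + (f *: w Y + v Y)) //.
by rewrite wl vl !scalerDr !scalerA (mulrC f g) addrACA.
Qed.
HB.instance Definition _ := GRing.isSubmodClosed.Build (Cinf M)
  (XM -> (Cinf M)^o) oneform_pred oneform_pred_submod.
HB.instance Definition _ := [SubChoice_isSubZmodule of oneform by <:].
HB.instance Definition _ := [SubZmodule_isSubLmodule of oneform by <:].

Lemma oneformP (w : oneform) f (X Y : XM) : w (f *: X + Y) = f * w X + w Y.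
Proof. by have /asboolP := oneform_valP w; apply. Qed.

Record tensor02 := Tensor02 {
  tensor02_val :> XM -> XM -> Cinf M;
  tensor02_linl : forall Z f X Y,
    tensor02_val (f *: X + Y) Z = f * tensor02_val X Z + tensor02_val Y Z;
  tensor02_linr : forall Z f X Y,
    tensor02_val Z (f *: X + Y) = f * tensor02_val Z X + tensor02_val Z Y }.

Fact flat_subproof (h : tensor02) (X : XM) :
  (h X : XM -> (Cinf M)^o) \in oneform_pred.
Proof. by apply/asboolP => f Y Z; rewrite tensor02_linr. Qed.
Definition flat (h : tensor02) (X : XM) : oneform :=
  OneForm (flat_subproof h X).

Definition symmetric02 (h : tensor02) := forall X Y, h X Y = h Y X.

(* Nondegeneracy on each tangent space: every tangent vector at p is the value
   at p of some vector field, and X vanishes at p iff X f p = 0 for all f. *)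
Definition nondegenerate02 (h : tensor02) := forall (p : M) (X : XM),
  (forall Y, h X Y p = 0) -> (forall f : Cinf M, (X f : Cinf M) p = 0).

Definition h_symmetric (h : tensor02) (J : {linear XM -> XM}) :=
  forall X Y, h (J X) Y = h X (J Y).

Fact transpose_subproof (J : {linear XM -> XM}) (w : oneform) :
  (fun X => w (J X)) \in oneform_pred.
Proof. by apply/asboolP => f X Y; rewrite linearP oneformP. Qed.
Definition transpose (J : {linear XM -> XM}) (w : oneform) : oneform :=
  OneForm (transpose_subproof J w).

(* R-homogeneity of D_X follows from the Leibniz rule for constant f. *)
Record connection := Connection {
  conn_val :> XM -> XM -> XM;
  conn_linear : forall Z f X Y,
    conn_val (f *: X + Y) Z = f *: conn_val X Z + conn_val Y Z;
  conn_additive : forall X Y Z,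
    conn_val X (Y + Z) = conn_val X Y + conn_val X Z;
  conn_leibniz : forall X f Y,
    conn_val X (f *: Y) = (X f : Cinf M) *: Y + f *: conn_val X Y }.

Definition torsion_free (D : connection) :=
  forall X Y, D X Y - D Y X = lie X Y.

Definition cov02 (D : connection) (h : tensor02) (X Y Z : XM) : Cinf M :=
  X (h Y Z) - h (D X Y) Z - h Y (D X Z).

Definition cov11 (D : connection) (J : {linear XM -> XM}) (X Y : XM) : XM :=
  D X (J Y) - J (D X Y).

Definition F_tensor (D : connection) (h : tensor02) (J : {linear XM -> XM})
    (X Y Z : XM) : Cinf M :=
  h (cov11 D J X Y) Z.

Fact cov_form_subproof (D : connection) (X : XM) (w : oneform) :
  (fun Y => X (w Y) - w (D X Y) : (Cinf M)^o) \in oneform_pred.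
Proof.
apply/asboolP => f Y Z.
rewrite conn_additive conn_leibniz -addrA !oneformP vfieldD vfieldM.
rewrite -[f *: _]/(f * ((X (w Y) : Cinf M) - w (D X Y))) mulrBr.
suff aux (V : zmodType) (a b c d e : V) :
    a + b + c - (a + (d + e)) = b - d + (c - e) by exact: aux.
by rewrite -(addrA a) opprD addrACA subrr add0r opprD addrACA.
Qed.
Definition cov_form (D : connection) (X : XM) (w : oneform) : oneform :=
  OneForm (cov_form_subproof D X w).

Definition statistical (h : tensor02) (D : connection) :=
  torsion_free D /\ forall X Y Z, cov02 D h X Y Z = cov02 D h Y X Z.

Definition dual_connection (h : tensor02) (D D' : connection) :=
  forall X Y Z : XM, X (h Y Z) = h (D X Y) Z + h Y (D' X Z).

Lemma affine_leibniz (K : comPzRingType) (V : lmodType K) (a b f x : K)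
    (u v w : V) : a + b = 1 ->
  a *: (x *: u + f *: v) + b *: (x *: u + f *: w)
  = x *: u + f *: (a *: v + b *: w).
Proof.
move=> ab; rewrite !scalerDr addrACA -scalerDl ab scale1r !scalerA.
by rewrite (mulrC a) (mulrC b).
Qed.

Section AlphaConnection.
Variables (D D' : connection) (alpha : R).
Let a : Cinf M := Cinf_cst M ((1 + alpha) / 2).
Let b : Cinf M := Cinf_cst M ((1 - alpha) / 2).
Let conn (X Y : XM) : XM := a *: D X Y + b *: D' X Y.

Let conn_lin Z f X Y : conn (f *: X + Y) Z = f *: conn X Z + conn Y Z.
Proof.
rewrite /conn !conn_linear !scalerDr !scalerA (mulrC a) (mulrC b).
by rewrite addrACA.
Qed.

Let conn_add X Y Z : conn X (Y + Z) = conn X Y + conn X Z.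
Proof. by rewrite /conn !conn_additive !scalerDr addrACA. Qed.

Let conn_leib X f Y : conn X (f *: Y) = (X f : Cinf M) *: Y + f *: conn X Y.
Proof.
rewrite /conn !conn_leibniz; apply: affine_leibniz.
rewrite /a /b /Cinf_cst -scalerDl -mulrDl addrACA subrr addr0.
by rewrite -[1 + 1]/(2%:R) divff ?pnatr_eq0// scale1r.
Qed.

Definition alpha_connection : connection :=
  Connection conn_lin conn_add conn_leib.

End AlphaConnection.

(* A section X + eta of TM (+) T*M is the pair (X, eta). *)
Definition gbracket (D : connection) (s t : XM * oneform) : XM * oneform :=
  (lie s.1 t.1, cov_form D s.1 t.2 - cov_form D t.1 s.2).

Definition nijenhuis (D : connection) (K : XM * oneform -> XM * oneform)
    (s t : XM * oneform) : XM * oneform :=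
  gbracket D (K s) (K t) - K (gbracket D (K s) t) - K (gbracket D s (K t))
  + K (K (gbracket D s t)).

(* hinv stands for h^-1 : T*M -> TM. *)
Definition Jhat (h : tensor02) (hinv : oneform -> XM) (J : {linear XM -> XM})
    (s : XM * oneform) : XM * oneform :=
  (J s.1 + (hinv s.2 - J (J (hinv s.2))), flat h s.1 - transpose J s.2).

End Tensors.

(* Main.v *)
(* Let C = nabla h, a totally symmetric tensor. By duality
   h(nabla'_X Y - nabla_X Y, Z) = C(X, Y, Z), so the brackets of nabla^(alpha)
   and nabla differ by a (1 - alpha)/2 multiple of the 1-form
     delta(X + flat E, Y + flat B) = C(Y, E, .) - C(X, B, .).
   Hence the Nijenhuis tensors differ by the same multiple of
     delta(K s, K t) - K delta(K s, t) - K delta(s, K t) + delta(s, t),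
   where K = Jhat is an involution. If C(JX, Y, Z) = C(X, JY, Z), then K is
   skew for delta and everything cancels; conversely, for s = X and t = Y the
   expression reduces to C(JY, X, .) - C(JX, Y, .). Finally the cyclic
   combination of F equals C(JX, Y, Z) - C(X, JY, Z), because
   F(X, Y, Z) - F(X, Z, Y) = C(X, Y, JZ) - C(X, JY, Z). *)
Require Import Defs.
From HB Require Import structures.
From mathcomp Require Import all_boot all_order all_algebra.
From mathcomp Require Import all_classical all_reals topology normedtype derive.
From mathcomp Require Import ring.
Import Order.TTheory GRing.Theory Num.Theory.
Local Open Scope ring_scope.

(** * Additivity of tensors and of the Nijenhuis expression *)

Section Pairing.
Context {R : realType} {n : nat} {M : manifold R n}.
Local Notation XM := (vfield M).
Local Notation OM := (oneform M).
Implicit Types (X Y Z : XM) (w v : OM) (h : tensor02 M) (D : connection M).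

Lemma oneform_eq w v : (forall X, w X = v X) -> w = v.
Proof. by move=> wv; apply/val_inj/funext. Qed.

Lemma oneformD w X Y : w (X + Y) = w X + w Y.
Proof. by have := oneformP w 1 X Y; rewrite scale1r mul1r. Qed.

Lemma oneformB w X Y : w (X - Y) = w X - w Y.
Proof. by rewrite addrC -scaleN1r oneformP mulN1r addrC. Qed.

Lemma oneformZ w f X : w (f *: X) = f * w X.
Proof. by rewrite -[f *: X]addr0 oneformP -(subrr X) oneformB subrr addr0. Qed.

Lemma tensor02Dl h X Y Z : h (X + Y) Z = h X Z + h Y Z.
Proof. by have := tensor02_linl h Z 1 X Y; rewrite scale1r mul1r. Qed.

Lemma tensor02Bl h X Y Z : h (X - Y) Z = h X Z - h Y Z.
Proof. by rewrite addrC -scaleN1r tensor02_linl mulN1r addrC. Qed.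

Lemma tensor02Br h X Y Z : h X (Y - Z) = h X Y - h X Z.
Proof. exact: (oneformB (flat h X)). Qed.

Lemma flatB h X Y : flat h (X - Y) = flat h X - flat h Y.
Proof. by apply: oneform_eq => Z; apply: tensor02Bl. Qed.

Lemma transposeB (J : {linear XM -> XM}) w v :
  transpose J (w - v) = transpose J w - transpose J v.
Proof. exact: oneform_eq. Qed.

(** The connection enters only through the bracket, and [K] is additive, so differences of brackets
    pass through each term. *)
Lemma nijenhuis_subl D D' (K : XM * OM -> XM * OM)
    (K_additive : forall s t, K (s - t) = K s - K t)
    (delta := fun s t => gbracket D' s t - gbracket D s t) s t :
  nijenhuis D' K s t - nijenhuis D K s t =
  delta (K s) (K t) - K (delta (K s) t) - K (delta s (K t))
  + K (K (delta s t)).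
Proof.
rewrite /nijenhuis /delta !K_additive.
suff aux (V : zmodType) (a b c d a' b' c' d' : V) :
    a - b - c + d - (a' - b' - c' + d')
    = a - a' - (b - b') - (c - c') + (d - d') by exact: aux.
by rewrite !opprD (addrACA _ d) (addrACA _ (- c)) (addrACA a).
Qed.

End Pairing.

Section AlphaNijenhuis.
Context {R : realType} {n : nat} {M : manifold R n}.
Local Notation XM := (vfield M).
Local Notation OM := (oneform M).
Variables (h : tensor02 M) (hinv : OM -> XM).
Hypothesis h_sym : symmetric02 h.
Hypotheses (hK : cancel (flat h) hinv) (hinvK : cancel hinv (flat h)).
Variables (nabla nabla' : connection M).
Hypothesis h_stat : statistical h nabla.
Hypothesis nabla'_dual : dual_connection h nabla nabla'.
Variable J : {linear XM -> XM}.
Hypothesis J_sym : h_symmetric h J.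
Implicit Types (X Y Z : XM) (w v : OM) (s t : XM * OM).
Local Notation C := (cov02 nabla h).
Local Notation K := (Jhat h hinv J).
Local Notation F := (F_tensor nabla h J).

(** * Algebra of [hinv] and of [Jhat] *)

Lemma hinvB w v : hinv (w - v) = hinv w - hinv v.
Proof. by rewrite -{1}(hinvK w) -{1}(hinvK v) -flatB hK. Qed.

Lemma hinvE w X : w X = h (hinv w) X.
Proof. by rewrite -[in LHS](hinvK w). Qed.

(** This is the $h$-symmetry of [J], read through the isomorphism [flat h]; it makes the
    off-diagonal blocks of [Jhat] squared cancel. *)
Lemma hinv_transpose w : hinv (transpose J w) = J (hinv w).
Proof.
rewrite -[RHS]hK; congr hinv; apply: oneform_eq => X /=.
by rewrite hinvE J_sym.
Qed.

Lemma JhatB s t : K (s - t) = K s - K t.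
Proof.
congr pair => /=.
  rewrite hinvB !(raddfB J).
  suff aux (V : zmodType) (a b c d e f : V) :
      a - b + (c - d - (e - f)) = a + (c - e) - (b + (d - f)) by exact: aux.
  by rewrite !opprD (addrACA c) (addrACA a).
by rewrite flatB transposeB !opprD addrACA.
Qed.

Lemma JhatN s : K (- s) = - K s.
Proof.
have K0 : K 0 = 0 by rewrite -[in LHS](subrr 0) JhatB subrr.
by rewrite -[- s]sub0r JhatB K0 sub0r.
Qed.

Lemma JhatK : involutive K.
Proof.
move=> [X w]; rewrite /Jhat /=; congr pair.
  rewrite hinvB hK hinv_transpose (raddfD J) !(raddfB J).
  suff aux (V : zmodType) (a b c d : V) :
      a + (b - c) + (d - b - (a - c)) = d by exact: aux.
  by rewrite -(addrA d) -opprD (addrCA b) [LHS]addrC subrK.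
apply: oneform_eq => Y.
rewrite -[LHS]/(h (J X + (hinv w - J (J (hinv w)))) Y
                - (h X (J Y) - (w (J (J Y)) : Cinf M))).
rewrite tensor02Dl tensor02Bl !J_sym !(hinvE w).
ring.
Qed.

(** * The cubic tensor [C] *)

Lemma cov02_dual X Y Z : C X Y Z = h Y (nabla' X Z - nabla X Z).
Proof. by rewrite /cov02 nabla'_dual tensor02Br addrAC addrC addrA addKr. Qed.

Lemma cov02C23 X Y Z : C X Y Z = C X Z Y.
Proof. by rewrite /cov02 (h_sym Y) (h_sym _ Z) (h_sym Y) addrAC. Qed.

Lemma cov02C12 X Y Z : C X Y Z = C Y X Z.
Proof. by case: h_stat => _; apply. Qed.

(** In the form [cov02_dual] no derivative is left, so additivity is inherited from [h]. *)
Lemma cov02B2 X Y1 Y2 Z : C X (Y1 - Y2) Z = C X Y1 Z - C X Y2 Z.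
Proof. by rewrite !cov02_dual tensor02Bl. Qed.

Lemma cov02D1 X1 X2 Y Z : C (X1 + X2) Y Z = C X1 Y Z + C X2 Y Z.
Proof. by rewrite !(cov02C12 _ Y) !cov02_dual tensor02Dl. Qed.

Lemma cov02B1 X1 X2 Y Z : C (X1 - X2) Y Z = C X1 Y Z - C X2 Y Z.
Proof. by rewrite !(cov02C12 _ Y) cov02B2. Qed.

(** The derivatives of [h Y (J Z)] and [h (J Y) Z] cancel by symmetry of [J]; the four connection
    terms left are those of [F]. *)
Lemma F_antisym X Y Z : F X Y Z - F X Z Y = C X Y (J Z) - C X (J Y) Z.
Proof.
rewrite /F_tensor /cov11 /cov02 !tensor02Bl !J_sym.
rewrite (h_sym (nabla X (J Z))) (h_sym (nabla X Z)) J_sym.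
ring.
Qed.

Lemma F_cyclic X Y Z :
  F X Y Z + F Y Z X - F X Z Y - F Y X Z = C (J X) Y Z - C X (J Y) Z.
Proof.
(* Pair the terms with the same first argument; total symmetry then cancels [C X Y (J Z)] against
   [C Y (J Z) X]. *)
rewrite -addrA addrACA !F_antisym.
rewrite (cov02C12 X Y (J Z)) (cov02C23 Y X (J Z)) addrC addrA subrK.
by rewrite (cov02C23 Y) (cov02C12 Y).
Qed.

(** * Difference of the brackets *)

Lemma Cinf_cst_half (alpha : R) :
  Cinf_cst M ((1 + alpha) / 2) = 1 - Cinf_cst M ((1 - alpha) / 2).
Proof.
rewrite /Cinf_cst -[X in X - _]scale1r -scalerBl; congr (_ *: _).
by field.
Qed.

Definition gbracket_diff (alpha : R) s t :=
  gbracket (alpha_connection nabla nabla' alpha) s t - gbracket nabla s t.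

Lemma gbracket_diff1 alpha s t : (gbracket_diff alpha s t).1 = 0.
Proof. exact: subrr. Qed.

(** The alpha-connection is [nabla] plus $(1-\alpha)/2$ times [nabla' - nabla], and a form [w]
    evaluated on [nabla' X Z - nabla X Z] is [C X (hinv w) Z]. *)
Lemma gbracket_diff2 alpha s t Z :
  (gbracket_diff alpha s t).2 Z =
  Cinf_cst M ((1 - alpha) / 2)
  * (C t.1 (hinv s.2) Z - C s.1 (hinv t.2) Z).
Proof.
have aux X w :
    (cov_form (alpha_connection nabla nabla' alpha) X w Z : Cinf M)
    = cov_form nabla X w Z
      - Cinf_cst M ((1 - alpha) / 2) * w (nabla' X Z - nabla X Z).
  rewrite -[LHS]/((X (w Z) : Cinf M)
    - w (Cinf_cst M ((1 + alpha) / 2) *: nabla X Z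
         + Cinf_cst M ((1 - alpha) / 2) *: nabla' X Z)).
  rewrite -[cov_form nabla X w Z]/((X (w Z) : Cinf M) - w (nabla X Z)).
  rewrite oneformB (oneformD w (_ *: _)) !(oneformZ w) Cinf_cst_half.
  ring.
rewrite !cov02_dual -!hinvE.
set D := alpha_connection nabla nabla' alpha in aux *.
rewrite -[LHS]/((cov_form D s.1 t.2 Z : Cinf M) - cov_form D t.1 s.2 Z
  - ((cov_form nabla s.1 t.2 Z : Cinf M) - cov_form nabla t.1 s.2 Z)).
rewrite !aux.
ring.
Qed.

Lemma hinv_Jhat2 s : hinv (K s).2 = s.1 - J (hinv s.2).
Proof. by rewrite /= hinvB hK hinv_transpose. Qed.

Lemma gbracket_diff_eqN alpha s t s' t' :
    (forall Z, (gbracket_diff alpha s t).2 Z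
               = - ((gbracket_diff alpha s' t').2 Z : Cinf M)) ->
  gbracket_diff alpha s t = - gbracket_diff alpha s' t'.
Proof.
move=> diffN; apply: injective_projections; last exact: oneform_eq.
rewrite -[RHS]/(- (gbracket_diff alpha s' t').1).
by rewrite !gbracket_diff1 oppr0.
Qed.

Lemma gbracket_diff_skew alpha s t :
    (forall X Y Z, C (J X) Y Z = C X (J Y) Z) ->
  gbracket_diff alpha (K s) t = - gbracket_diff alpha s (K t).
Proof.
move=> CJ; apply: gbracket_diff_eqN => Z.
rewrite !gbracket_diff2 !hinv_Jhat2 !cov02B2 /= !(cov02D1 (J _)) !cov02B1.
(* Moving one [J] across makes both sides [C] of two [J]-images, symmetric in the two vectors; this
   disposes of the $J^2$ block. *)
have -> : C (J (J (hinv s.2))) (hinv t.2) Z = C (J (J (hinv t.2))) (hinv s.2) Z.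
  by rewrite !CJ cov02C12 CJ.
rewrite !CJ (cov02C12 t.1 s.1) (cov02C12 (hinv t.2) (hinv s.2)).
ring.
Qed.

(** * Comparison of the Nijenhuis tensors *)

Lemma nijenhuis_alpha_sub alpha s t :
  nijenhuis (alpha_connection nabla nabla' alpha) K s t
  - nijenhuis nabla K s t =
  gbracket_diff alpha (K s) (K t) - K (gbracket_diff alpha (K s) t)
  - K (gbracket_diff alpha s (K t)) + gbracket_diff alpha s t.
Proof. by rewrite (nijenhuis_subl _ _ _ JhatB) JhatK. Qed.

Lemma nijenhuis_alpha_eq alpha s t :
    (forall X Y Z, C (J X) Y Z = C X (J Y) Z) ->
  nijenhuis (alpha_connection nabla nabla' alpha) K s t = nijenhuis nabla K s t.
Proof.
move=> CJ; apply/eqP; rewrite -subr_eq0 nijenhuis_alpha_sub.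
(* Skewness used on the first term gives minus the last one, since [K] is an involution; the two
   middle terms cancel. *)
rewrite !(gbracket_diff_skew _ _ _ CJ) JhatK JhatN.
by rewrite opprK addrK addNr.
Qed.

Lemma cov02J_of_nijenhuis X Y Z :
    nijenhuis (alpha_connection nabla nabla' (- 1)) K (X, 0) (Y, 0)
    = nijenhuis nabla K (X, 0) (Y, 0) ->
  C (J X) Y Z = C X (J Y) Z.
Proof.
have hinv0 : hinv 0 = 0 by rewrite -[in LHS](subrr 0) hinvB subrr.
have J0 : J 0 = 0 by exact: raddf0.
have C20 U V : C U 0 V = 0 by rewrite -[in LHS](subrr 0) cov02B2 subrr.
(* At $\alpha=-1$ the alpha-connection is the dual one and the factor is 1. *)
have b1 : Cinf_cst M ((1 - -1) / 2) = 1.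
  by rewrite opprK -[1 + 1]/(2%:R) divff ?pnatr_eq0 // /Cinf_cst scale1r.
have diffE := gbracket_diff2 (-1); rewrite b1 in diffE.
pose s : XM * OM := (X, 0); pose t : XM * OM := (Y, 0).
(* With zero form parts only [C Y X] and [C X Y] survive, so skewness needs just the Codazzi
   symmetry. *)
have skew : gbracket_diff (-1) (K s) t = - gbracket_diff (-1) s (K t).
  apply: gbracket_diff_eqN => U.
  rewrite !diffE !hinv_Jhat2 /= hinv0 J0 !subr0 !C20.
  by rewrite subr0 sub0r mulrN opprK cov02C12.
move/eqP; rewrite -subr_eq0 -/s -/t nijenhuis_alpha_sub skew JhatN opprK addrK.
move=> /eqP diff0.
have : ((gbracket_diff (-1) (K s) (K t)).2 Z : Cinf M)
    + (gbracket_diff (-1) s t).2 Z = 0.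
  suff aux (p q : XM * OM) : (p.2 Z : Cinf M) + q.2 Z = (p + q).2 Z.
    by rewrite aux diff0.
  by [].
rewrite !diffE !hinv_Jhat2 /= hinv0 J0 !subr0 !C20 J0 !subrr !addr0.
rewrite mulr0 addr0 mul1r cov02C12 => /eqP.
by rewrite subr_eq0 => /eqP.
Qed.

End AlphaNijenhuis.

Theorem proposition4p9 (R : realType) (n : nat) (M : manifold R n)
    (h : tensor02 M) (h_sym : symmetric02 h) (h_nondeg : nondegenerate02 h)
    (hinv : oneform M -> vfield M)
    (hK : cancel (flat h) hinv) (hinvK : cancel hinv (flat h))
    (nabla : connection M) (h_stat : statistical h nabla)
    (nabla' : connection M) (nabla'_dual : dual_connection h nabla nabla')
    (J : {linear vfield M -> vfield M}) (J_sym : h_symmetric h J) :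
  (forall (alpha : R) (X Y : vfield M) (eta beta : oneform M),
     nijenhuis (alpha_connection nabla nabla' alpha) (Jhat h hinv J)
       (X, eta) (Y, beta)
     = nijenhuis nabla (Jhat h hinv J) (X, eta) (Y, beta))
  <->
  (forall X Y Z : vfield M,
     F_tensor nabla h J X Y Z + F_tensor nabla h J Y Z X
     - F_tensor nabla h J X Z Y - F_tensor nabla h J Y X Z = 0).
Proof.
split=> [N X Y Z|H alpha X Y eta beta].
  rewrite (F_cyclic h h_sym nabla h_stat J J_sym); apply/eqP.
  rewrite subr_eq0; apply/eqP.
  apply: (cov02J_of_nijenhuis h hinv hK hinvK nabla nabla' h_stat nabla'_dual
            J J_sym).
  exact: N.
apply: (nijenhuis_alpha_eq h hinv hK hinvK nabla nabla' h_stat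
          nabla'_dual J J_sym) => U V W.
apply/eqP; rewrite -subr_eq0 -(F_cyclic h h_sym nabla h_stat J J_sym).
by apply/eqP; apply: H.
Qed.
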